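(* For every $p\in[1,\infty]$ and any two finite mm-spaces $(X,d_X,\mu_X)$ and $(Y,d_Y,\mu_Y)$, $$d^{E,p}_{\mathrm{CatMM}}(X,Y)=2\,d_{\mathrm{GW}_p}(X,Y).$$
   Context: A finite mm-space $(X,d_X,\mu_X)$ is a non-empty finite metric space $(X,d_X)$ with a probability measure $\mu_X$ of full support. **CatMM.** Objects: finite mm-spaces. Morphisms $(X,d_X,\mu_X)\to(Y,d_Y,\mu_Y)$: functions $f:X\to Y$ such that (1) $d_X(x_1,x_2)\le d_X(x_3,x_4)$ implies $d_Y(f(x_1),f(x_2))\le d_Y(f(x_3),f(x_4))$ for all $x_1,\dots,x_4\in X$; (2) $f_\#\mu_X=\mu_Y$ (pushforward measure). The $p$-cost of $f$ is $\big(\sum_{x,x'\in X}|d_X(x,x')-d_Y(f(x),f(x'))|^p\mu_X(x)\mu_X(x')\big)^{1/p}$ for $p\in[1,\infty)$, and $\max_{x,x'\in X}|d_X(x,x')-d_Y(f(x),f(x'))|$ for $p=\infty$. **$p$-edit distance.** A path between objects $A,B$ is a finite sequence of morphisms $A\leftrightarrow D_1\leftrightarrow\cdots\leftrightarrow D_{k-1}\leftrightarrow B$, each $\leftrightarrow$ being a morphism in either direction; its $p$-cost is the sum of the $p$-costs of its morphisms. $d^{E,p}_{\mathrm{CatMM}}(A,B)$ is the infimum of the $p$-costs of all paths between $A$ and $B$ (with $\inf\emptyset=+\infty$). **$p$-Gromov-Wasserstein distance.** A coupling of $\mu_X,\mu_Y$ is a probability measure $\mu$ on $X\times Y$ with marginals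 $\mu_X,\mu_Y$. For $p<\infty$, $\mathrm{dis}_p(\mu)=\big(\sum_{x,x'\in X,\,y,y'\in Y}|d_X(x,x')-d_Y(y,y')|^p\mu(x,y)\mu(x',y')\big)^{1/p}$; $\mathrm{dis}_\infty(\mu)=\max_{(x,y),(x',y')\in\mathrm{supp}(\mu)}|d_X(x,x')-d_Y(y,y')|$. $d_{\mathrm{GW}_p}(X,Y)=\frac12\inf_\mu\mathrm{dis}_p(\mu)$ over all couplings $\mu$. *)

(* Defs.v *)
From mathcomp Require Import all_boot all_order all_algebra.
From mathcomp Require Import all_classical all_reals all_analysis.

Set Implicit Arguments.
Unset Strict Implicit.
Unset Printing Implicit Defensive.

Import Order.TTheory GRing.Theory Num.Theory.

Local Open Scope classical_set_scope.
Local Open Scope ring_scope.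

(* A probability measure on a finite set (with all subsets measurable) is given
   by its point masses. *)
Record fprob (R : realType) (T : finType) := FProb {
  pmass :> T -> R;
  pmass_ge0 : forall t, 0 <= pmass t;
  pmass_sum1 : \sum_t pmass t = 1 }.

Definition push (R : realType) (T U : finType) (f : T -> U) (m : T -> R) :
  U -> R := fun u => \sum_(t | f t == u) m t.

(* The metric axioms are those of [isMetric]; nonnegativity follows from them. *)
Record mmspace (R : realType) := MMSpace {
  mmcar :> finType;
  mmdist : mmcar -> mmcar -> R;
  mmprob : fprob R mmcar;
  mm_nonempty : (0 < #|mmcar|)%N;
  mmdistxx : forall x, mmdist x x = 0;
  mmdist_positivity : forall x y, mmdist x y = 0 -> x = y;
  mmdist_sym : forall x y, mmdist x y = mmdist y x;
  mmdist_triangle : forall y x z, mmdist x z <= mmdist x y + mmdist y z;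
  mm_full_support : forall x, 0 < mmprob x }.

Record mmhom (R : realType) (X Y : mmspace R) := MMHom {
  mmfun :> X -> Y;
  mmhom_mono : forall x1 x2 x3 x4 : X, mmdist x1 x2 <= mmdist x3 x4 ->
    mmdist (mmfun x1) (mmfun x2) <= mmdist (mmfun x3) (mmfun x4);
  mmhom_push : forall y : Y, push mmfun (mmprob X) y = mmprob Y y }.

(* Exponents are [p : \bar R] with [1 <= p]; the value at [-oo] is junk.  All the
   maxima are over nonnegative families, hence the neutral element 0. *)
Definition hom_cost (R : realType) (p : \bar R) (X Y : mmspace R)
    (f : mmhom X Y) : R :=
  match p with
  | r%:E => (\sum_(x : X) \sum_(x' : X)
      `|mmdist x x' - mmdist (f x) (f x')| `^ r * mmprob X x * mmprob X x')
        `^ r^-1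
  | +oo%E => \big[Num.max/0]_(x : X) \big[Num.max/0]_(x' : X)
      `|mmdist x x' - mmdist (f x) (f x')|
  | -oo%E => 0
  end.

Inductive mmstep (R : realType) (X Y : mmspace R) : Type :=
| Forward of mmhom X Y
| Backward of mmhom Y X.

Definition step_cost (R : realType) (p : \bar R) (X Y : mmspace R)
    (s : mmstep X Y) : R :=
  match s with
  | Forward f => hom_cost p f
  | Backward f => hom_cost p f
  end.

Inductive mmpath (R : realType) (A B : mmspace R) : Type :=
| PathStep of mmstep A B
| PathCons (D : mmspace R) of mmstep A D & mmpath D B.

Fixpoint path_cost (R : realType) (p : \bar R) (A B : mmspace R)
    (w : mmpath A B) : R :=
  match w with
  | PathStep s => step_cost p s
  | PathCons _ s w' => step_cost p s + path_cost p w'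
  end.

Definition edit_dist (R : realType) (p : \bar R) (A B : mmspace R) : \bar R :=
  ereal_inf [set c | exists w : mmpath A B, c = (path_cost p w)%:E].

Definition is_coupling (R : realType) (X Y : mmspace R)
    (m : fprob R (X * Y)%type) : Prop :=
  (forall x, push fst m x = mmprob X x) /\
  (forall y, push snd m y = mmprob Y y).

Definition dis (R : realType) (p : \bar R) (X Y : mmspace R)
    (m : fprob R (X * Y)%type) : R :=
  match p with
  | r%:E => (\sum_(x : X) \sum_(x' : X) \sum_(y : Y) \sum_(y' : Y)
      `|mmdist x x' - mmdist y y'| `^ r * m (x, y) * m (x', y')) `^ r^-1
  | +oo%E => \big[Num.max/0]_(u : X * Y | 0 < m u)
               \big[Num.max/0]_(v : X * Y | 0 < m v)
                 `|mmdist u.1 v.1 - mmdist u.2 v.2|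
  | -oo%E => 0
  end.

Definition gw_dist (R : realType) (p : \bar R) (X Y : mmspace R) : \bar R :=
  ((2^-1)%:E * ereal_inf
    [set c | exists m : fprob R (X * Y)%type,
               is_coupling m /\ c = (dis p m)%:E])%E.

(* Main.v *)
Require Import Defs.
From mathcomp Require Import all_boot all_order all_algebra.
From mathcomp Require Import all_classical all_reals all_analysis.
From mathcomp Require Import ring lra.

(** Twice the Gromov-Wasserstein distance is the infimum of the distortions of
couplings, so two comparisons suffice: a path can be turned into a coupling
that distorts no more than the path costs, and a coupling can be turned into a
path that costs exactly its distortion.

From paths to couplings ([coupling_of_path]).  For a probability [n] on a
finite set and a real function [F] of two points, let the norm of [F] be its
L^p norm for the product measure of [n] with itself.  The cost of a morphism
and the distortion of a coupling are both such norms of a difference of two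
pulled back distances, and the norm depends only on the image measure
([wnorm_sqw_push]).  Put a common probability space above the two ends of a
step [A <-> D] and a coupling of [D] and [Y]; the decomposition
[d_A - d_Y = (d_A - d_D) + (d_D - d_Y)] and the Minkowski inequality then show
that the induced coupling of [A] and [Y] has distortion at most the cost of the
step plus the distortion of the coupling of [D] and [Y] ([glue_coupling]).

From couplings to paths ([path_of_coupling]).  Let [Z] be the support of a
coupling [m] of [X] and [Y], with the distance [d_t = t d_X + (1 - t) d_Y].
For [0 < t < 1] this is a metric, because two pairs at distance 0 agree in both
coordinates; at [t = 1] and [t = 0] it is the pullback of the distances of [X]
and [Y].  The monotonicity condition on morphisms asks exactly that the order of the
distances in the source refine the one in the target.  Since [Z] is finite,
strict inequalities between values of [d_t] persist for [s] near [t], so the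
order of [d_s] refines that of [d_t], and the identity of [Z] is a morphism
from [(Z, d_s)] to [(Z, d_t)]: arrows point towards the more degenerate
parameter.  As [d_s - d_t = (s - t) (d_X - d_Y)], it costs [|s - t| dis m].
A supremum argument joins finitely many of these morphisms into a path
from [Y] at [t = 0] to [X] at [t = 1], along which the costs telescope to
[dis m]. *)

Set Implicit Arguments.
Unset Strict Implicit.
Unset Printing Implicit Defensive.

Import Order.TTheory GRing.Theory Num.Theory.
Import numFieldNormedType.Exports.

Local Open Scope classical_set_scope.
Local Open Scope ring_scope.

(** * Weighted L^p norms on finite sets *)

(** The essential supremum at [p = +oo], with points of weight 0 discarded, is
what makes this norm invariant under change of variables for every [p]. *)
Definition wnorm (R : realType) (p : \bar R) (I : finType) (w F : I -> R) : R :=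
  match p with
  | r%:E => (\sum_i `|F i| `^ r * w i) `^ r^-1
  | +oo%E => \big[Num.max/0]_(i | 0 < w i) `|F i|
  | -oo%E => 0
  end.

Definition sqw (R : realType) (T : finType) (m : T -> R) : T * T -> R :=
  fun u => m u.1 * m u.2.

Section WeightedNorm.
Variables (R : realType).
Implicit Types (p : \bar R) (I J : finType).

Lemma eq_wnorm p I (w F G : I -> R) : F =1 G -> wnorm p w F = wnorm p w G.
Proof. by move=> /funext ->. Qed.

Lemma wnorm_pushforward p I J (f : I -> J) (v F : J -> R) (w : I -> R) :
  (forall i, 0 <= w i) -> push f w =1 v ->
  wnorm p w (F \o f) = wnorm p v F.
Proof.
move=> w0 vE; case: p => [r||]//=.
  congr (_ `^ _); rewrite (partition_big f xpredT)//=.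
  apply: eq_bigr => j _; rewrite -vE /push mulr_sumr.
  by apply: eq_bigr => i /eqP <-.
apply/le_anti/andP; split; apply/bigmax_leP; split=> //.
- exact: bigmax_ge_id.
- move=> i wi; apply: (le_bigmax_cond _ (fun j => `|F j|)).
  by rewrite -vE /push (bigD1 i)//= ltr_pwDl// sumr_ge0.
- exact: bigmax_ge_id.
- move=> j; rewrite -vE /push => vj.
  have [i /andP[/eqP <- wi]|none] := pickP (fun i => (f i == j) && (0 < w i)).
    exact: (le_bigmax_cond _ (fun i => `|F (f i)|)).
  move: vj; rewrite big1 ?ltxx// => i fi; have := none i; rewrite fi /=.
  by rewrite lt_neqAle w0 andbT; case: eqVneq.
Qed.

Lemma wnormZ p I (w F : I -> R) (c : R) : (1 <= p)%E -> (forall i, 0 <= w i) ->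
  wnorm p w (fun i => c * F i) = `|c| * wnorm p w F.
Proof.
case: p => [r||] //= p1 w0.
- have r0 : r != 0 by rewrite gt_eqF// (lt_le_trans ltr01).
  have -> : \sum_i `|c * F i| `^ r * w i = `|c| `^ r * \sum_i `|F i| `^ r * w i.
    by rewrite mulr_sumr; apply: eq_bigr => i _; rewrite normrM powRM// mulrA.
  rewrite powRM ?powR_ge0//; last first.
    by apply: sumr_ge0 => i _; rewrite mulr_ge0// powR_ge0.
  by rewrite -powRrM mulfV// powRr1.
- have -> : `|c| * \big[Num.max/0]_(i | 0 < w i) `|F i| =
      \big[Num.max/0]_(i | 0 < w i) (`|c| * `|F i|).
    by apply: big_endo => [x y|]; rewrite ?mulr0// maxr_pMr.
  by apply: eq_bigr => i _; rewrite normrM.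
Qed.

Lemma wnorm_subC p I (w F G : I -> R) :
  wnorm p w (fun i => F i - G i) = wnorm p w (fun i => G i - F i).
Proof.
have FG i : `|F i - G i| = `|G i - F i| by rewrite distrC.
case: p => [r| |] /=; last by [].
  by congr (_ `^ _); apply: eq_bigr => i _; rewrite FG.
by apply: eq_bigr => i _; rewrite FG.
Qed.

(** The Minkowski inequality for norm bounds [a] and [b] that are positive, so
that [F / a] and [G / b] make sense: [(F + G) / (a + b)] is their convex
combination with weights [a / (a + b)] and [b / (a + b)], and [x ^ r] is
convex. *)
Lemma minkowski_bound I (w F G : I -> R) (r a b : R) : 1 <= r ->
  (forall i, 0 <= w i) -> 0 < a -> 0 < b ->
  \sum_i `|F i| `^ r * w i <= a `^ r -> \sum_i `|G i| `^ r * w i <= b `^ r ->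
  \sum_i `|F i + G i| `^ r * w i <= (a + b) `^ r.
Proof.
move=> r1 w0 a0 b0 Fa Gb.
have r0 : 0 <= r by rewrite (le_trans ler01).
have ab0 : 0 < a + b by rewrite addr_gt0.
pose t := a / (a + b).
have t0 : 0 <= t by rewrite divr_ge0// ltW.
have t1 : t <= 1 by rewrite ler_pdivrMr// mul1r lerDl ltW.
have normalize (c : R) (H : I -> R) : 0 < c ->
    \sum_i `|H i| `^ r * w i <= c `^ r ->
    \sum_i (`|H i| / c) `^ r * w i <= 1.
  move=> c0 Hc; rewrite -(ler_pM2l (powR_gt0 r c0)) mulr1; apply: le_trans Hc.
  rewrite mulr_sumr ler_sum// => i _.
  by rewrite mulrA -powRM ?divr_ge0 ?(ltW c0)// mulrCA mulfV ?gt_eqF// mulr1.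
have pointwise i : `|F i + G i| `^ r <=
   (a + b) `^ r * (t * (`|F i| / a) `^ r + (1 - t) * (`|G i| / b) `^ r).
  have A0 : 0 <= `|F i| / a by rewrite divr_ge0// ltW.
  have B0 : 0 <= `|G i| / b by rewrite divr_ge0// ltW.
  have := convex_powR r1 (Itv01 t0 t1) (x := `|F i| / a) (y := `|G i| / b).
  rewrite !inE/= !in_itv/= !andbT => /(_ A0 B0).
  rewrite !convRE/= => conv.
  apply: le_trans (ler_wpM2l (powR_ge0 _ _) conv).
  have t1' : 0 <= 1 - t by rewrite subr_ge0.
  have C0 : 0 <= t * (`|F i| / a) + (1 - t) * (`|G i| / b).
    exact: (addr_ge0 (mulr_ge0 t0 A0) (mulr_ge0 t1' B0)).
  rewrite -(powRM _ (ltW ab0) C0).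
  have -> : (a + b) * (t * (`|F i| / a) + (1 - t) * (`|G i| / b)) =
      `|F i| + `|G i| by rewrite /t; field; rewrite !gt_eqF.
  by rewrite ge0_ler_powR ?nnegrE ?addr_ge0// ler_normD.
apply: (@le_trans _ _ ((a + b) `^ r * (t * \sum_i (`|F i| / a) `^ r * w i +
    (1 - t) * \sum_i (`|G i| / b) `^ r * w i))).
  rewrite !mulr_sumr -big_split/= mulr_sumr; apply: ler_sum => i _.
  apply: le_trans (ler_wpM2r (w0 i) (pointwise i)) _.
  by rewrite le_eqVlt; apply/orP; left; apply/eqP; ring.
rewrite -[leRHS]mulr1 ler_wpM2l ?powR_ge0//.
rewrite -[leRHS](subrKC t) lerD//.
  by rewrite ler_piMr// normalize.
by rewrite ler_piMr ?subr_ge0// normalize.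
Qed.

(** The norms of [F] and [G] may vanish, so [minkowski_bound] is applied to
slightly larger bounds. *)
Lemma wnorm_triangle p I (w F G : I -> R) : (1 <= p)%E -> (forall i, 0 <= w i) ->
  wnorm p w (F \+ G) <= wnorm p w F + wnorm p w G.
Proof.
case: p => [r||] //= p1 w0; last first.
  apply/bigmax_leP; split=> [|i wi]; first by rewrite addr_ge0// bigmax_ge_id.
  apply: le_trans (ler_normD _ _) (lerD _ _).
    exact: (le_bigmax_cond _ (fun i => `|F i|)).
  exact: (le_bigmax_cond _ (fun i => `|G i|)).
have r1 : 1 <= r by rewrite -lee_fin.
have r0 : 0 < r by rewrite (lt_le_trans ltr01).
have S0 (H : I -> R) : 0 <= \sum_i `|H i| `^ r * w i.
  by rewrite sumr_ge0// => i _; rewrite mulr_ge0// powR_ge0.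
have sum_le (H : I -> R) (e : R) : 0 < e -> \sum_i `|H i| `^ r * w i <=
    ((\sum_i `|H i| `^ r * w i) `^ r^-1 + e) `^ r.
  move=> e0; rewrite -[leLHS](powRr1 (S0 H)) -(mulVf (lt0r_neq0 r0)) powRrM.
  by rewrite ge0_ler_powR ?nnegrE ?addr_ge0 ?powR_ge0 ?lerDl ?(ltW r0) ?(ltW e0).
apply/ler_addgt0Pr => e e0; have e20 : 0 < e / 2 by rewrite divr_gt0.
have pos (H : I -> R) : 0 < (\sum_i `|H i| `^ r * w i) `^ r^-1 + e / 2.
  by rewrite ltr_wpDl ?powR_ge0.
have := minkowski_bound r1 w0 (pos F) (pos G) (sum_le F _ e20) (sum_le G _ e20).
have := addr_gt0 (pos F) (pos G).
have -> (x y : R) : x + e / 2 + (y + e / 2) = x + y + e by field.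
move: (_ + e) => c c0 le_c.
rewrite -[leRHS](powRr1 (ltW c0)) -(mulfV (lt0r_neq0 r0)) powRrM.
by rewrite ge0_ler_powR ?nnegrE ?powR_ge0 ?invr_ge0 ?(ltW r0) ?S0.
Qed.

End WeightedNorm.

(** * Image measures *)

Section Pushforward.
Variable R : realType.
Implicit Types T U V : finType.

Lemma push_comp T U V (f : T -> U) (g : U -> V) (m : T -> R) :
  push g (push f m) =1 push (g \o f) m.
Proof.
move=> v; rewrite /push [RHS](partition_big f (fun u => g u == v))//=.
apply: eq_bigr => u /eqP <-; apply: eq_bigl => t.
by case: eqVneq => [->|]; rewrite ?eqxx ?andbF.
Qed.

Lemma eq_push T U (f g : T -> U) (m n : T -> R) :
  f =1 g -> m =1 n -> push f m =1 push g n.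
Proof. by move=> /funext -> /funext ->. Qed.

Lemma push_ge0 T U (f : T -> U) (m : T -> R) :
  (forall t, 0 <= m t) -> forall u, 0 <= push f m u.
Proof. by move=> m0 u; apply: sumr_ge0. Qed.

Lemma sum_push T U (f : T -> U) (m : T -> R) : \sum_u push f m u = \sum_t m t.
Proof. by rewrite [RHS](partition_big f xpredT). Qed.

Definition fprob_push T U (f : T -> U) (m : fprob R T) : fprob R U :=
  @FProb R U (push f m) (push_ge0 f (@pmass_ge0 R T m))
    (etrans (sum_push f m) (pmass_sum1 m)).

Lemma sqw_ge0 T (m : T -> R) :
  (forall t, 0 <= m t) -> forall u, 0 <= sqw m u.
Proof. by move=> m0 u; rewrite mulr_ge0. Qed.

Lemma push_sqw T U (f : T -> U) (m : T -> R) :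
  push (fun u => (f u.1, f u.2)) (sqw m) =1 sqw (push f m).
Proof.
case=> u v; rewrite /push /sqw /= big_distrlr/= pair_big/=.
by apply: eq_bigl => -[s t]; rewrite xpair_eqE.
Qed.

Lemma wnorm_sqw_push (p : \bar R) T U (f : T -> U) (m : T -> R) (n : U -> R)
    (F : U * U -> R) :
  (forall t, 0 <= m t) -> push f m =1 n ->
  wnorm p (sqw m) (fun u => F (f u.1, f u.2)) = wnorm p (sqw n) F.
Proof.
move=> m0 /funext <-.
by rewrite -(wnorm_pushforward p F (sqw_ge0 m0) (push_sqw f m)).
Qed.

End Pushforward.

(** * From paths to couplings *)

Section Couplings.
Variable R : realType.
Implicit Types (p : \bar R) (X Y D : mmspace R).

Lemma dis_wnorm p X Y (m : fprob R (X * Y)%type) :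
  dis p m = wnorm p (sqw m)
    (fun u => mmdist u.1.1 u.2.1 - mmdist u.1.2 u.2.2).
Proof.
case: p => [r||]//=.
  have sum_pair (S T : finType) (F : S * T -> R) :
      \sum_u F u = \sum_s \sum_t F (s, t).
    by rewrite pair_bigA; apply: eq_bigr => -[].
  congr (_ `^ _); rewrite sum_pair sum_pair; apply: eq_bigr => x _.
  under [RHS]eq_bigr do rewrite sum_pair.
  rewrite [RHS]exchange_big; apply: eq_bigr => x' _; apply: eq_bigr => y _.
  by apply: eq_bigr => y' _; rewrite mulrA.
apply/le_anti/andP; split; apply/bigmax_leP; split=> //.
- exact: bigmax_ge_id.
- move=> u mu; apply/bigmax_leP; split=> [|v mv]; first exact: bigmax_ge_id.
  apply: (le_bigmax_cond _ (fun u : (X * Y) * (X * Y) =>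
    `|mmdist u.1.1 u.2.1 - mmdist u.1.2 u.2.2|) (j := (u, v))).
  by rewrite mulr_gt0.
- exact: bigmax_ge_id.
- case=> u v; rewrite /sqw/= => muv.
  have mu : 0 < m u.
    rewrite lt0r pmass_ge0 andbT; apply: contraTN muv => /eqP ->.
    by rewrite mul0r ltxx.
  have mv : 0 < m v.
    rewrite lt0r pmass_ge0 andbT; apply: contraTN muv => /eqP ->.
    by rewrite mulr0 ltxx.
  apply: le_trans (le_bigmax_cond _ _ mu).
  exact: (le_bigmax_cond _ (fun v => `|mmdist u.1 v.1 - mmdist u.2 v.2|)).
Qed.

(** At [p = +oo] the cost is a maximum over all points, which agrees with the
essential supremum because the measure has full support. *)
Lemma hom_cost_wnorm p X Y (f : mmhom X Y) :
  hom_cost p f = wnorm p (sqw (mmprob X))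
    (fun u => mmdist u.1 u.2 - mmdist (f u.1) (f u.2)).
Proof.
case: p => [r||]//=.
  congr (_ `^ _); rewrite pair_bigA/=.
  by apply: eq_bigr => u _; rewrite mulrA.
apply/le_anti/andP; split; apply/bigmax_leP; split=> //.
- exact: bigmax_ge_id.
- move=> x _; apply/bigmax_leP; split=> [|x' _]; first exact: bigmax_ge_id.
  apply: (le_bigmax_cond _ (fun u : X * X =>
    `|mmdist u.1 u.2 - mmdist (f u.1) (f u.2)|) (j := (x, x'))).
  by rewrite mulr_gt0// mm_full_support.
- exact: bigmax_ge_id.
- case=> x x' _.
  apply: le_trans (le_bigmax_cond _ _ (isT : xpredT x)).
  exact: (le_bigmax_cond _ (fun x' => `|mmdist x x' - mmdist (f x) (f x')|)).
Qed.

Lemma dis_fprob_push p X Y (T : finType) (n : fprob R T) (g : T -> X) (h : T -> Y) :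
  dis p (fprob_push (fun t => (g t, h t)) n) = wnorm p (sqw n)
    (fun u => mmdist (g u.1) (g u.2) - mmdist (h u.1) (h u.2)).
Proof.
rewrite dis_wnorm; symmetry.
exact: (@wnorm_sqw_push _ p _ _ (fun t => (g t, h t)) n _ (fun u =>
  mmdist u.1.1 u.2.1 - mmdist u.1.2 u.2.2) (@pmass_ge0 _ _ n) (frefl _)).
Qed.

Lemma coupling_fprob_push X Y (T : finType) (n : fprob R T) (g : T -> X) (h : T -> Y) :
  push g n =1 mmprob X -> push h n =1 mmprob Y ->
  is_coupling (fprob_push (fun t => (g t, h t)) n).
Proof. by move=> gn hn; split=> z; rewrite push_comp. Qed.

(** A finite probability space over [X], [D] and [Y] that realises a given
coupling of [D] and [Y] also couples [X] and [Y], and on it the distortions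
satisfy the triangle inequality. *)
Lemma glue_coupling p X D Y (m : fprob R (D * Y)%type) (T : finType)
    (n : fprob R T) (x : T -> X) (d : T -> D) (y : T -> Y) : (1 <= p)%E ->
  is_coupling m -> push x n =1 mmprob X -> push (fun t => (d t, y t)) n =1 m ->
  exists2 m' : fprob R (X * Y)%type, is_coupling m' & dis p m' <=
    wnorm p (sqw n) (fun u => mmdist (x u.1) (x u.2) - mmdist (d u.1) (d u.2))
    + dis p m.
Proof.
move=> p1 [_ mY] nX nm; exists (fprob_push (fun t => (x t, y t)) n).
  apply: coupling_fprob_push => // b.
  by rewrite -mY -(eq_push (frefl snd) nm) push_comp.
rewrite dis_fprob_push dis_wnorm -(wnorm_sqw_push p _ (@pmass_ge0 _ _ n) nm)/=.
apply: le_trans (wnorm_triangle _ _ p1 (sqw_ge0 (@pmass_ge0 _ _ n))).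
rewrite le_eqVlt; apply/orP; left; apply/eqP/eq_wnorm => u /=; ring.
Qed.

(** A step of either direction is glued by choosing the probability space of
[glue_coupling].  For a morphism out of [D], the coupling of [D] and [Y] itself
serves; for a morphism into [D] it is the fibre product of that coupling with
[X] over [D]. *)
Lemma coupling_backward p X D Y (f : mmhom D X) (m : fprob R (D * Y)%type) :
  (1 <= p)%E -> is_coupling m ->
  exists2 m' : fprob R (X * Y)%type,
    is_coupling m' & dis p m' <= hom_cost p f + dis p m.
Proof.
move=> p1 mC; have [mD _] := mC.
have [||m' m'C m'le] := @glue_coupling p X D Y m _ m (f \o fst) fst snd p1 mC.
- by move=> x; rewrite -push_comp -(mmhom_push f); apply: eq_push.
- by case=> d y; rewrite /push (big_pred1 (d, y))// => -[].
exists m' => //; rewrite hom_cost_wnorm wnorm_subC.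
by rewrite -(wnorm_sqw_push p _ (@pmass_ge0 _ _ m) mD).
Qed.

Section FiberProduct.
Variables (X D Y : mmspace R) (f : mmhom X D) (m : fprob R (D * Y)%type).
Hypothesis mC : is_coupling m.

(** The fibre product of [X] and [D * Y] over [D] is identified with [X * Y]:
draw [x] in [X], then [y] according to the conditional law given [f x]. *)
Let n (u : X * Y) : R := mmprob X u.1 * (m (f u.1, u.2) / mmprob D (f u.1)).

Let n_ge0 u : 0 <= n u.
Proof. by rewrite mulr_ge0 ?divr_ge0 ?pmass_ge0. Qed.

Let push_fst_n : push fst n =1 mmprob X.
Proof.
move=> x; rewrite /push (reindex_onto (pair x) snd) => [|[? ?] /eqP <-]//=.
rewrite (eq_bigl xpredT) => [|y]; last by rewrite !eqxx.
rewrite /n/= -mulr_sumr -mulr_suml; have [mD _] := mC.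
suff -> : \sum_y m (f x, y) = mmprob D (f x).
  by rewrite divff ?mulr1// gt_eqF// mm_full_support.
rewrite -mD /push (reindex_onto (pair (f x)) snd) => [|[? ?] /eqP <-]//=.
by apply: eq_bigl => y; rewrite !eqxx.
Qed.

Let push_n : push (fun u => (f u.1, u.2)) n =1 m.
Proof.
case=> d y; rewrite /push (reindex_onto (pair^~ y) fst) => [|[? ?]]/=; last first.
  by rewrite xpair_eqE => /andP[_ /eqP <-].
under eq_bigl do rewrite xpair_eqE !eqxx !andbT.
rewrite (eq_bigr (fun x => mmprob X x * (m (d, y) / mmprob D d))); last first.
  by move=> x /eqP <-.
have := mmhom_push f d; rewrite /push -mulr_suml => ->.
by rewrite mulrC divfK// gt_eqF// mm_full_support.
Qed.

Let n_sum1 : \sum_u n u = 1.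
Proof.
by rewrite -(sum_push fst) (eq_bigr _ (fun x _ => push_fst_n x)) pmass_sum1.
Qed.

Lemma coupling_forward p : (1 <= p)%E ->
  exists2 m' : fprob R (X * Y)%type,
    is_coupling m' & dis p m' <= hom_cost p f + dis p m.
Proof.
move=> p1; have [m' m'C m'le] := @glue_coupling p X D Y m _ (FProb n_ge0 n_sum1)
  fst (f \o fst) snd p1 mC push_fst_n push_n.
exists m' => //; rewrite hom_cost_wnorm.
by rewrite -(wnorm_sqw_push p _ n_ge0 push_fst_n).
Qed.

End FiberProduct.

Lemma coupling_refl p X : (1 <= p)%E ->
  exists2 m : fprob R (X * X)%type, is_coupling m & dis p m = 0.
Proof.
move=> p1; exists (fprob_push (fun x => (x, x)) (mmprob X)).
  by apply: coupling_fprob_push => x; rewrite /push (big_pred1 x).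
rewrite dis_fprob_push -[RHS](mul0r (wnorm p (sqw (mmprob X)) (fun=> 0))).
rewrite -[in RHS](@normr0 _ R) -wnormZ//; last exact/sqw_ge0/pmass_ge0.
by apply: eq_wnorm => u; rewrite subrr mul0r.
Qed.

(** Starting from the diagonal coupling at the far end of the path, the steps
are glued on one by one, last step first. *)
Lemma coupling_of_path p X Y (w : mmpath X Y) : (1 <= p)%E ->
  exists2 m : fprob R (X * Y)%type, is_coupling m & dis p m <= path_cost p w.
Proof.
move=> p1.
have step A D (s : mmstep A D) (m : fprob R (D * Y)%type) : is_coupling m ->
    exists2 m' : fprob R (A * Y)%type,
      is_coupling m' & dis p m' <= step_cost p s + dis p m.
  by case: s => f mC; [exact: coupling_forward|exact: coupling_backward].
elim: w step => {X Y} [X Y s|X Y D s w IH] step /=.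
  have [m0 m0C m00] := coupling_refl Y p1.
  by have [m mC] := step _ _ s _ m0C; rewrite m00 addr0; exists m.
have [m mC mle] := IH step; have [m' m'C m'le] := step _ _ s _ mC.
by exists m' => //; apply: le_trans m'le _; rewrite lerD2l.
Qed.

End Couplings.

(** * From couplings to paths *)

Lemma mmdist_ge0 (R : realType) (W : mmspace R) (x y : W) : 0 <= mmdist x y.
Proof.
by have := mmdist_triangle y x x; rewrite mmdistxx (mmdist_sym y x); lra.
Qed.

Section Interpolation.
Variables (R : realType) (X Y : mmspace R).
Implicit Types u v : X * Y.

Definition interp (t : R) u v : R :=
  t * mmdist u.1 v.1 + (1 - t) * mmdist u.2 v.2.

Definition refines (s t : R) : Prop := forall u v u' v',
  interp s u v <= interp s u' v' -> interp t u v <= interp t u' v'.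

(** A strict inequality between two of the finitely many values of [interp t]
remains strict for all nearby parameters; this is the contrapositive of
[refines s t].  The inequalities that hold with equality at [t] may be broken
in either way, hence the direction of the refinement. *)
Lemma refines_near (t : R) :
  exists2 e : R, 0 < e & forall s, `|s - t| < e -> refines s t.
Proof.
have : \forall s \near t, forall a : ((X * Y) * (X * Y)) * ((X * Y) * (X * Y)),
    interp t a.2.1 a.2.2 < interp t a.1.1 a.1.2 ->
    interp s a.2.1 a.2.2 < interp s a.1.1 a.1.2.
  apply: (@filter_forall R _ (fun a s =>
    interp t a.2.1 a.2.2 < interp t a.1.1 a.1.2 ->
    interp s a.2.1 a.2.2 < interp s a.1.1 a.1.2) (nbhs t)).
  move=> -[[u v] [u' v']] /=.
  have [lt_t|_] := boolP (interp t u' v' < interp t u v); last exact: nearW.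
  have cvg_interp a b : interp s a b @[s --> t] --> interp t a b.
    apply: cvgD; first exact: cvgMl.
    by apply: cvgMl; apply: cvgB => //; exact: cvg_cst.
  near=> s => _; rewrite -subr_gt0.
  near: s; apply: (cvgr_gt (interp t u v - interp t u' v')).
    exact: cvgB.
  by rewrite subr_gt0.
case/nbhs_ballP => e /= e0 near_t; exists e => // s st u v u' v'.
apply: contraTT; rewrite -!ltNge => /(near_t s _ ((u, v), (u', v'))); apply.
by rewrite /ball/= distrC.
Unshelve. all: by end_near. Qed.

Variable m : fprob R (X * Y)%type.
Hypothesis mC : is_coupling m.

(** Only the support of the coupling can carry an mm-space, as these have full
support. *)
Let Z := {u : X * Y | 0 < m u}.

Lemma push_supp : push val (fun z : Z => m (val z)) =1 m.
Proof.
move=> u; rewrite /push; have [mu|] := boolP (0 < m u).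
  by rewrite (big_pred1 (Sub u mu : Z)) // => z; rewrite -val_eqE.
rewrite lt0r pmass_ge0 andbT negbK => /eqP mu0; rewrite mu0 big1// => z /eqP zu.
by have := valP z; rewrite /= zu mu0 ltxx.
Qed.

Definition supp_prob : fprob R Z := @FProb R Z (fun z => m (val z))
  (fun z => pmass_ge0 m (val z))
  (etrans (esym (sum_push val _)) (etrans (eq_bigr _ (fun u _ => push_supp u))
    (pmass_sum1 m))).

Lemma supp_nonempty : (0 < #|{: Z}|)%N.
Proof.
rewrite lt0n; apply/eqP => /card0_eq Z0.
have := pmass_sum1 supp_prob; rewrite big_pred0 => [/eqP|z]; last exact: Z0.
by rewrite eq_sym oner_eq0.
Qed.

Section Intermediate.
Variables (t : R) (t0 : 0 < t) (t1 : t < 1).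

Let t1' : 0 < 1 - t. Proof. by rewrite subr_gt0. Qed.

Let interpxx (z : Z) : interp t (val z) (val z) = 0.
Proof. by rewrite /interp !mmdistxx !mulr0 addr0. Qed.

Let interp_positivity (z z' : Z) : interp t (val z) (val z') = 0 -> z = z'.
Proof.
move=> /eqP; rewrite /interp paddr_eq0 ?mulr_ge0 ?mmdist_ge0 ?(ltW t0) ?(ltW t1')//.
rewrite !mulf_eq0 (gt_eqF t0) (gt_eqF t1')/= => /andP[/eqP d1 /eqP d2].
apply: val_inj; rewrite [LHS]surjective_pairing [RHS]surjective_pairing.
by rewrite (mmdist_positivity d1) (mmdist_positivity d2).
Qed.

Let interp_sym (z z' : Z) : interp t (val z) (val z') = interp t (val z') (val z).
Proof. by rewrite /interp (mmdist_sym (val z).1) (mmdist_sym (val z).2). Qed.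

Let interp_triangle (z' z z'' : Z) : interp t (val z) (val z'') <=
  interp t (val z) (val z') + interp t (val z') (val z'').
Proof.
rewrite /interp addrACA -!mulrDr lerD// ler_wpM2l ?mmdist_triangle//; exact: ltW.
Qed.

Definition intermediate : mmspace R :=
  @MMSpace R Z (fun z z' => interp t (val z) (val z')) supp_prob supp_nonempty
    interpxx interp_positivity interp_sym interp_triangle (fun z => valP z).

(** The target distance is only required to be [interp s] after pullback, so
that one statement covers the morphisms to another intermediate space and,
with [s = 1] or [s = 0], the projections to [X] and [Y]. *)
Lemma intermediate_hom (s : R) (W : mmspace R) (g : intermediate -> W) :
  push g supp_prob =1 mmprob W ->
  (forall z z' : Z, mmdist (g z) (g z') = interp s (val z) (val z')) ->
  refines t s ->
  exists f : mmhom intermediate W,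
    forall p, (1 <= p)%E -> hom_cost p f = `|t - s| * dis p m.
Proof.
move=> gW gd ts.
have mono (x1 x2 x3 x4 : intermediate) : mmdist x1 x2 <= mmdist x3 x4 ->
    mmdist (g x1) (g x2) <= mmdist (g x3) (g x4).
  by rewrite !gd; exact: ts.
exists (MMHom mono gW) => p p1.
rewrite hom_cost_wnorm dis_wnorm -wnormZ//; last exact/sqw_ge0/pmass_ge0.
rewrite -(wnorm_sqw_push p _ (@pmass_ge0 _ _ supp_prob) push_supp).
by apply: eq_wnorm => u /=; rewrite !gd /interp; ring.
Qed.

End Intermediate.

Lemma push_supp_fst : push (fun z : Z => (val z).1) supp_prob =1 mmprob X.
Proof.
move=> x; rewrite -mC.1 -(push_comp val fst).
by apply: eq_push => //; exact: push_supp.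
Qed.

Lemma push_supp_snd : push (fun z : Z => (val z).2) supp_prob =1 mmprob Y.
Proof.
move=> x; rewrite -mC.2 -(push_comp val snd).
by apply: eq_push => //; exact: push_supp.
Qed.

(** Let [S] be the set of parameters [t] whose intermediate space is joined to
[Y] by a path of cost [t * dis p m], and [T] its supremum.  Some [t] in [S] is
close enough to [T] for the order at [t] to refine that at [T]; this gives a
morphism to the space at [T].  If [T = 1], that space may be taken to be [X]
and the path is complete.  Otherwise the same happens from a parameter
[T + d], which would also lie in [S]. *)
Lemma path_of_coupling p : (1 <= p)%E ->
  exists w : mmpath X Y, path_cost p w = dis p m.
Proof.
move=> p1.
pose S : set R := [set t | exists (t0 : 0 < t) (t1 : t < 1)
  (w : mmpath (intermediate t0 t1) Y), path_cost p w = t * dis p m].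
have [s s0 Ss] : exists2 s, 0 < s & S s.
  have [e e0 near0] := refines_near 0.
  have s0 : 0 < Num.min e 1 / 2 by rewrite divr_gt0// lt_min e0/=.
  have lt_s : Num.min e 1 / 2 < Num.min e 1 by lra.
  have s1 : Num.min e 1 / 2 < 1 by rewrite (lt_le_trans lt_s)// ge_min lexx orbT.
  exists (Num.min e 1 / 2) => //; exists s0, s1.
  have [||f fE] := @intermediate_hom _ s0 s1 0 Y (fun z => (val z).2) push_supp_snd.
  - by move=> z z'; rewrite /interp mul0r add0r subr0 mul1r.
  - by apply: near0; rewrite subr0 gtr0_norm// (lt_le_trans lt_s)// ge_min lexx.
  by exists (PathStep (Forward f)); rewrite /= fE// subr0 gtr0_norm.
have S1 : ubound S 1 by move=> t [t0 [t1 _]]; exact: ltW.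
have supS : has_sup S by split; [exists s|exists 1].
set T := sup S.
have T0 : 0 < T by rewrite (lt_le_trans s0)// ub_le_sup//; exists 1.
have T1 : T <= 1 by rewrite ge_sup//; exists s.
have [e e0 nearT] := refines_near T.
have [t [t0 [t1 [w wE]]] lt_t] := sup_adherent e0 supS.
have le_t : t <= T by apply: ub_le_sup; [exists 1|exists t0, t1, w].
have tT : refines t T.
  by apply: nearT; rewrite ler0_norm ?subr_le0//; rewrite -/T in lt_t; lra.
(* The costs of consecutive steps add up, as t stays below T. *)
have costE : `|t - T| * dis p m + t * dis p m = T * dis p m.
  by rewrite ler0_norm ?subr_le0//; ring.
have [T1'|T1'] := ltP T 1; last first.
  have TE : T = 1 by apply/le_anti; rewrite T1.
  have [||f fE] := @intermediate_hom _ t0 t1 T X (fun z => (val z).1) push_supp_fst.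
  - by move=> z z'; rewrite TE /interp subrr mul0r addr0 mul1r.
  - exact: tT.
  by exists (PathCons (Backward f) w); rewrite /= fE// wE costE TE mul1r.
exfalso.
have push_id : push (fun z : Z => z) supp_prob =1 supp_prob.
  by move=> z; rewrite /push big_pred1_eq.
have [||f fE] := @intermediate_hom _ t0 t1 T (intermediate T0 T1') id push_id.
- by [].
- exact: tT.
pose d := Num.min e (1 - T) / 2.
have d0 : 0 < d by rewrite divr_gt0// lt_min e0 subr_gt0.
have de : d < e.
  rewrite (@lt_le_trans _ _ (Num.min e (1 - T)))// ?ge_min ?lexx//.
  by rewrite /d in d0 *; lra.
have dT : d < 1 - T.
  rewrite (@lt_le_trans _ _ (Num.min e (1 - T)))// ?ge_min ?lexx ?orbT//.
  by rewrite /d in d0 *; lra.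
have Td0 : 0 < T + d by rewrite addr_gt0.
have Td1 : T + d < 1 by lra.
have [||h hE] := @intermediate_hom _ Td0 Td1 T (intermediate T0 T1') id push_id.
- by [].
- by apply: nearT; rewrite addrAC subrr add0r gtr0_norm.
suff /(ub_le_sup (ex_intro _ 1 S1)) : S (T + d) by rewrite -/T; lra.
exists Td0, Td1, (PathCons (Forward h) (PathCons (Backward f) w)).
by rewrite /= hE// fE// wE costE addrAC subrr add0r gtr0_norm// -mulrDl addrC.
Qed.

End Interpolation.

Theorem proposition3p2p3 (R : realType) (p : \bar R) (hp : (1 <= p)%E)
    (X Y : mmspace R) :
  edit_dist p X Y = (2%:E * gw_dist p X Y)%E.
Proof.
rewrite /gw_dist muleA -EFinM mulfV// mul1e.
apply/le_anti/andP; split; apply: le_ereal_inf_tmp => c /=.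
  move=> [m [mC ->]]; have [w <-] := path_of_coupling mC hp.
  by apply: ereal_inf_lbound; exists w.
move=> [w ->]; have [m mC mle] := coupling_of_path w hp.
apply: le_trans (ereal_inf_lbound _) (_ : (dis p m)%:E <= _)%E; first by exists m.
by rewrite lee_fin.
Qed.
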